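(* Let $d\ge 2$, let $\mathcal{G}$ be a $d$-regular Ramanujan graphing on $(X,\nu)$ and let $f:X\to\mathbb{R}$ be a function in $L^2(X)$ that is not $\nu$-almost everywhere constant. Then, in the process $\mu_f$ on the vertices of $T_d$, for any two vertices $v,w\in V(T_d)$ at distance $k$, the absolute value of the correlation of the values at $v$ and $w$ is at most $$\Bigl(k+1-\frac{2k}{d}\Bigr)\Bigl(\frac{1}{\sqrt{d-1}}\Bigr)^k .$$
   Context: Graphing: let $X$ be a Polish space with a Borel probability measure $\nu$. A graphing $\mathcal{G}$ on $(X,\nu)$ is a (simple, undirected) graph with vertex set $X$, bounded maximal degree and Borel measurable edge set $E(\mathcal{G})\subset X\times X$ such that $\int_A e(x,B)\,d\nu(x)=\int_B e(x,A)\,d\nu(x)$ for all measurable $A,B\subseteq X$, where $e(x,S)$ is the number of edges from $x$ to $S$. It is $d$-regular if every vertex has degree $d$. $\mathcal{G}$ acts on $L^2(X)=L^2(X,\nu)$ as a bounded self-adjoint operator by $(\mathcal{G}f)(x)=\sum_{(x,v)\in E(\mathcal{G})}f(v)$. For a $d$-regular graphing, the subspace $L^2_0(X)\subset L^2(X)$ of functions with integral zero is invariant under $\mathcal{G}$, and $\rho(\mathcal{G})$ denotes the operator norm of $\mathcal{G}$ restricted to $L^2_0(X)$. A $d$-regular graphing is Ramanujan if $\rho(\mathcal{G})\le 2\sqrt{d-1}$. The process $\mu_f$: $T_d$ is the infinite $d$-regular tree. $\mathrm{Hom}_0(T_d,\mathcal{G})$ is the set of maps $\phi:V(T_d)\to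 X$ such that the image of every edge of $T_d$ is an edge of $\mathcal{G}$ and $\phi$ is injective on the neighborhood of every vertex of $T_d$. It is equipped with the $\sigma$-algebra generated by the evaluation maps $\phi\mapsto\phi(v)$. There is a unique probability measure $\kappa$ on $\mathrm{Hom}_0(T_d,\mathcal{G})$ that is invariant under the action of $\mathrm{Aut}(T_d)$ (by precomposition) and such that for every $v\in V(T_d)$ the distribution of $\phi(v)$ is $\nu$ when $\phi$ is $\kappa$-random. The process $\mu_f$ is the random function $f\circ\phi:V(T_d)\to\mathbb{R}$, where $\phi$ is $\kappa$-random. The correlation of two real random variables with finite nonzero variances is their covariance divided by the product of their standard deviations. *)

(* Defs.v *)
From HB Require Import structures.
From mathcomp Require Import all_boot all_order all_algebra.
From mathcomp Require Import all_classical all_reals all_analysis.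

Set Implicit Arguments.
Unset Strict Implicit.
Unset Printing Implicit Defensive.
Import Order.TTheory GRing.Theory Num.Theory.
Import numFieldNormedType.Exports.
Local Open Scope card_scope.
Local Open Scope classical_set_scope.
Local Open Scope ring_scope.

Definition complete_distance (R : realType) (X : topologicalType)
    (dist : X -> X -> R) : Prop :=
  [/\ forall x y, dist x y = 0 <-> x = y,
      forall x y, dist x y = dist y x,
      forall x y z, dist x z <= dist x y + dist y z,
      forall x (A : set X),
        nbhs x A <-> exists2 e : R, 0 < e & [set y | dist x y < e] `<=` A &
      forall u : nat -> X,
        (forall e : R, 0 < e -> exists N, forall m n, (N <= m)%N -> (N <= n)%N ->
           dist (u m) (u n) < e) ->
        exists l : X, u @ \oo --> l].

Definition polish (R : realType) (X : topologicalType) : Prop :=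
  (exists2 D : set X, countable D & dense D) /\
  exists dist : X -> X -> R, complete_distance dist.

(* The points of X, with the Borel sigma-algebra. *)
Notation borel X := (g_sigma_algebraType (@open X)).

Section graphings.
Context {R : realType} {X : ptopologicalType}.
Implicit Types (nu : probability (borel X) R) (E : set (X * X)) (f : X -> R).

Definition neighbors E (x : X) : set X := [set y | E (x, y)].

Definition edges_to E (x : X) (S : set X) : \bar R :=
  counting (neighbors E x `&` S).

Record graphing nu E : Prop := Graphing {
  graphing_sym : forall x y, E (x, y) -> E (y, x);
  graphing_irr : forall x, ~ E (x, x);
  graphing_bounded : exists D : nat, forall x,
    exists2 m : nat, (m <= D)%N & neighbors E x #= `I_m;
  (* Borel for the product topology of X * X *)
  graphing_borel : <<s (@open (X * X)%type) >> E;
  graphing_preserving : forall A B : set (borel X),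
    measurable A -> measurable B ->
    (\int[nu]_(x in A) edges_to E x B = \int[nu]_(x in B) edges_to E x A)%E }.

Definition regular_graphing (d : nat) nu E : Prop :=
  graphing nu E /\ forall x, neighbors E x #= `I_d.

Definition graphing_op E f (x : X) : R := \sum_(y \in neighbors E x) f y.

Definition L2_0 nu : set (X -> R) :=
  [set f | f \in Lfun nu 2%:E /\ (\int[nu]_x (f x)%:E = 0)%E].

(* Operator norm of graphing_op on L2_0, as an extended real. *)
Definition rho nu E : \bar R :=
  ereal_sup [set 'N[nu]_2%:E[EFin \o graphing_op E f]%E | f in
    [set f | L2_0 nu f /\ ('N[nu]_2%:E[EFin \o f] <= 1)%E]].

Definition ramanujan (d : nat) nu E : Prop :=
  regular_graphing d nu E /\ (rho nu E <= (2 * Num.sqrt (d%:R - 1))%:E)%E.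

End graphings.

Section trees.
Context {V : choiceType}.
Implicit Type t : rel V.

(* The d-regular tree T_d (unique up to isomorphism). Simple cycles are the
   duplicate-free cyclic sequences of length at least 3. *)
Definition regular_tree (d : nat) t : Prop :=
  [/\ symmetric t, irreflexive t,
      forall v w, exists2 p, path t v p & last v p = w,
      forall c, (2 < size c)%N -> uniq c -> ~~ cycle t c &
      forall v, [set w | t v w] #= `I_d].

Definition at_distance t (v w : V) (k : nat) : Prop :=
  (exists p, [/\ path t v p, last v p = w & size p = k]) /\
  (forall p, path t v p -> last v p = w -> (k <= size p)%N).

Definition automorphism t (a : V -> V) : Prop :=
  bijective a /\ forall v w, t (a v) (a w) = t v w.

End trees.

Section homs.
Context {X : ptopologicalType} {V : choiceType}.
Variables (E : set (X * X)) (t : rel V).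

Definition is_hom0 : set (V -> X) :=
  [set phi | (forall u v, t u v -> E (phi u, phi v)) /\
             (forall v, set_inj [set u | t v u] phi)].

Lemma hom0_comp (a : V -> V) (phi : V -> X) :
  automorphism t a -> is_hom0 phi -> is_hom0 (phi \o a).
Proof.
move=> [/bij_inj inja ta] [homE inj]; split=> [u v tuv /=|v u w].
  by apply: homE; rewrite ta.
rewrite !inE /= => tu tw eq_phi; apply/inja/(inj (a v)) => //.
  by rewrite inE /= ta.
by rewrite inE /= ta.
Qed.

(* Measurable types are pointed in the library, so Hom_0 is given a base point
   phi0; this costs nothing, as a space with a probability is inhabited. *)
Definition Hom0 of set_type is_hom0 : Type := set_type is_hom0.

Variable phi0 : set_type is_hom0.
HB.instance Definition _ := Choice.on (Hom0 phi0).
HB.instance Definition _ := isPointed.Build (Hom0 phi0) phi0.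

Definition eval_at (v : V) (phi : Hom0 phi0) : borel X := val phi v.

Definition cylinders : set (set (Hom0 phi0)) :=
  \bigcup_v preimage_set_system setT (eval_at v) measurable.

Definition precomp (a : V -> V) (ha : automorphism t a) (phi : Hom0 phi0) :
    Hom0 phi0 :=
  SigSub (mem_set (hom0_comp ha (set_valP phi))).

End homs.

Arguments eval_at {X V E t} phi0 v phi.
Arguments cylinders {X V E t} phi0.
Arguments precomp {X V E t} phi0 {a} ha phi.

Notation Hom0_space phi0 := (g_sigma_algebraType (cylinders phi0)).

Section process.
Context {R : realType} {X : ptopologicalType} {V : choiceType}.
Context {E : set (X * X)} {t : rel V} {phi0 : set_type (is_hom0 E t)}.

(* The characterization of the measure kappa on Hom_0(T_d, G). *)
Definition is_kappa (nu : probability (borel X) R)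
    (kappa : probability (Hom0_space phi0) R) : Prop :=
  (forall (a : V -> V) (ha : automorphism t a) (A : set (Hom0_space phi0)),
     measurable A -> kappa (precomp phi0 ha @^-1` A) = kappa A) /\
  (forall (v : V) (B : set (borel X)),
     measurable B -> kappa (eval_at phi0 v @^-1` B) = nu B).

Definition process (f : X -> R) (v : V) (phi : Hom0_space phi0) : R :=
  f (eval_at phi0 v phi).

End process.

Definition correlation d (T : measurableType d) (R : realType)
    (P : probability T R) (Y Z : T -> R) : R :=
  fine (covariance P Y Z) /
  (Num.sqrt (fine ('V_P[Y])%E) * Num.sqrt (fine ('V_P[Z])%E)).

(* Main.v *)
(** The covering maps [phi] turn the process into a walk on the graphing: if [A]
is the graphing operator then the sum of [h (phi w)] over the neighbours [w] of
[u] is [(A h) (phi u)]. Automorphisms of the tree that fix [v] and exchange two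
children of a vertex show that the correlation of [f (phi v)] and [h (phi w)] is
the same for all children [w] of a vertex, so by induction the covariance at
distance [k] is [<f, q_k(A) f>], where [q_0 = 1], [q_1 = A/d] and
[(d-1) q_{k+2} = A q_{k+1} - q_k]. With [s] the square root of [d-1] and [A = 2 s y], one has
[s^k d q_k = 2 (d-1) T_k(y) + (d-2) U_{k-2}(y)], and [U_{k-2}] is a sum of Chebyshev
polynomials [T_j], with total weight [k-1]. Pell's identity
[T_j^2 + (1-y^2) U_{j-1}^2 = 1] and [|A| <= 2 s] on the functions of mean zero give
[|T_j(y)| <= 1], so no spectral theorem is needed.

For measurable [f], [A f] is measurable up to a null set because the hypothesis
of measure preservation, applied to a set and to its complement, forces the
lower and upper integrals of [x |-> e(x, B)] to agree. *)
From HB Require Import structures.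
Require Import Defs.
From mathcomp Require Import all_boot all_order all_algebra zify ring lra finmap.
From mathcomp Require Import all_classical all_reals all_analysis.
From mathcomp Require Import measurable_realfun.

Set Implicit Arguments.
Unset Strict Implicit.
Unset Printing Implicit Defensive.
Import Order.TTheory GRing.Theory Num.Theory.
Import numFieldNormedType.Exports HBSimple HBNNSimple.
Local Open Scope classical_set_scope.

(** * Automorphisms of the regular tree *)

Lemma card_eq_uniq_seq (T : choiceType) (A : set T) (d : nat) :
  (A #= `I_d)%card -> exists s : seq T, [/\ uniq s, size s = d & A = [set` s]].
Proof.
move=> Ad.
have Afin : finite_set A by apply/finite_setP; exists d.
exists (fset_set A); split; first exact: fset_uniq.
  exact: card_fset_set.
by rewrite fset_setK.
Qed.

Section tree.
Context {V : choiceType}.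
Variables (d : nat) (t : rel V).
Hypothesis ht : regular_tree d t.

Lemma tree_sym : symmetric t. Proof. by case: ht. Qed.
Lemma tree_irr : irreflexive t. Proof. by case: ht. Qed.

Lemma tree_nbr v : exists s : seq V, [/\ uniq s, size s = d & forall w, (w \in s) = t v w].
Proof.
case: ht => _ _ _ _ /(_ v)/card_eq_uniq_seq[s [us ss E]]; exists s; split=> // w.
by move/seteqP: E => [A B]; apply/idP/idP; [exact: B|exact: A].
Qed.

Definition nbr v : seq V := projT1 (cid (tree_nbr v)).

Lemma nbr_uniq v : uniq (nbr v).
Proof. by rewrite /nbr; case: cid => s []. Qed.

Lemma size_nbr v : size (nbr v) = d.
Proof. by rewrite /nbr; case: cid => s []. Qed.

Lemma mem_nbr v w : (w \in nbr v) = t v w.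
Proof. by rewrite /nbr; case: cid => s []. Qed.

(** * Distances and parents in the rooted tree *)

Lemma tree_walk r x : exists n, `[< exists p, [/\ path t r p, last r p = x & size p = n] >].
Proof.
case: ht => _ _ /(_ r x)[p pr lp] _ _.
by exists (size p); apply/asboolP; exists p.
Qed.

Definition tdist r x : nat := ex_minn (tree_walk r x).

Lemma tdist_path r x : exists p, [/\ path t r p, last r p = x & size p = tdist r x].
Proof. by rewrite /tdist; case: ex_minnP => m /asboolP. Qed.

Lemma tdist_min r p : path t r p -> tdist r (last r p) <= size p.
Proof.
move=> rp; rewrite /tdist; case: ex_minnP => m _; apply.
by apply/asboolP; exists p.
Qed.

Lemma tdistP r x k : at_distance t r x k <-> tdist r x = k.
Proof.
have [p [rp lp sp]] := tdist_path r x.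
split=> [[[q [rq lq <-]]] H|<-].
  by apply/eqP; rewrite eqn_leq -{1}lq tdist_min//= -sp H.
split; first by exists p.
by move=> q rq <-; exact: tdist_min.
Qed.

Lemma tdistxx r : tdist r r = 0.
Proof. by apply/eqP; rewrite -leqn0 (@tdist_min r [::]). Qed.

Lemma tdist_eq0 r x : (tdist r x == 0) = (x == r).
Proof.
apply/idP/eqP => [|->]; last by rewrite tdistxx.
by have [[|y p] [_ <- <-]] := tdist_path r x.
Qed.

Lemma tdist_le r x y : t x y -> tdist r y <= (tdist r x).+1.
Proof.
move=> txy; have [p [rp lp sp]] := tdist_path r x.
rewrite -sp -(size_rcons p y) -{1}(last_rcons r p y).
by apply: tdist_min; rewrite rcons_path rp lp.
Qed.

Lemma tree_parent r x : x != r -> exists2 y, t x y & (tdist r y).+1 = tdist r x.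
Proof.
move=> xr; have [p] := tdist_path r x.
case/lastP: p => [[_ E _]|p z [+ + +]]; first by rewrite -E eqxx in xr.
rewrite rcons_path last_rcons size_rcons => /andP[rp tz] zx sp.
rewrite {}zx in tz; exists (last r p); first by rewrite tree_sym.
apply/eqP; rewrite eqn_leq tdist_le// -sp andbT.
by rewrite ltnS tdist_min.
Qed.

(** Coming down from the root through parents, this walk avoids every other vertex at least as deep
    as [x]. *)
Lemma tree_walk_below r x : exists p, [/\ path t r p, last r p = x &
  forall z, z \in r :: p -> z = x \/ tdist r z < tdist r x].
Proof.
move En : (tdist r x) => n; elim: n x En => [|n IHn] x /eqP.
  rewrite tdist_eq0 => /eqP->; exists [::]; split=> // z.
  by rewrite inE => /eqP; left.
move=> /eqP En; have xr : x != r by rewrite -tdist_eq0 En.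
have [y txy] := tree_parent xr; rewrite En => -[yn].
have [p [rp lp H]] := IHn y yn.
exists (rcons p x); rewrite rcons_path rp lp last_rcons tree_sym txy; split=> // z.
rewrite -rcons_cons mem_rcons inE => /orP[/eqP|/H[->|]]; [by left|right..].
  by rewrite yn.
exact: leqW.
Qed.

(** Shortened to a simple path, the detour closes up through [x] into a simple cycle, of length at
    least 3 because [y != y']. *)
Lemma tree_no_detour x y y' p : t x y -> t x y' -> y != y' ->
  path t y p -> last y p = y' -> x \notin y :: p -> False.
Proof.
move=> txy txy' yy' yp lp xp.
move: lp; case/shortenP: yp => p' yp' up' sub lp'.
case: ht => _ _ _ acyc _.
have xp' : x \notin y :: p'.
  apply: contra xp; rewrite !inE => /orP[->//|/sub ->]; exact: orbT.
have /negP : ~~ cycle t (x :: y :: p').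
  apply: acyc; last by rewrite cons_uniq xp'.
  by case: p' lp' {yp' up' sub xp'} => //= E; rewrite E eqxx in yy'.
by apply; rewrite /= txy rcons_path yp' lp' tree_sym txy'.
Qed.

(** Otherwise the walk from [y] up to the root and down to [y'] would be a detour avoiding [x]. *)
Lemma tree_unique_parent r x y y' : t x y -> t x y' ->
  tdist r y <= tdist r x -> tdist r y' <= tdist r x -> y = y'.
Proof.
move=> txy txy' yx y'x; apply/eqP/negPn/negP => yy'.
have away z : t x z -> tdist r z <= tdist r x -> exists p,
    [/\ path t r p, last r p = z & x \notin r :: p].
  move=> txz zx; have [p [rp lp H]] := tree_walk_below r z; exists p; split=> //.
  apply/negP => /H[E|]; first by rewrite E tree_irr in txz.
  by rewrite ltnNge zx.
have [p [rp lp xp]] := away _ txy yx; have [q [rq lq xq]] := away _ txy' y'x.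
apply: (@tree_no_detour x y y' (rev (belast r p) ++ q)) => //.
- rewrite cat_path -lp rev_path; apply/andP; split.
    by apply: sub_path rp => a b; rewrite tree_sym.
  by case: p {rp lp xp} => //= z p; rewrite rev_cons last_rcons.
- rewrite last_cat -lp; case: p {rp lp xp} => //= z p.
  by rewrite rev_cons last_rcons.
- rewrite -cat_cons mem_cat negb_or; apply/andP; split; last first.
    by apply: contra xq; rewrite inE orbC => ->.
  by rewrite -lp -rev_rcons mem_rev -lastI.
Qed.

(** Equal depths are impossible, since the parent of [x] is its only neighbour that is not
    deeper. *)
Lemma tdist_edge r x y : t x y ->
  tdist r y = (tdist r x).+1 \/ tdist r x = (tdist r y).+1.
Proof.
move=> txy; have := tdist_le r txy; rewrite leq_eqVlt => /orP[/eqP|]; first by left.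
rewrite ltnS => yx; right.
have xr : x != r.
  apply: contraTneq txy => E; move: yx.
  by rewrite E tdistxx leqn0 tdist_eq0 => /eqP->; rewrite tree_irr.
have [z txz zx] := tree_parent xr.
by rewrite (@tree_unique_parent r x y z)// -zx.
Qed.

(** The filtered list is empty only at [x = r], where the default makes the root its own parent. *)
Definition par r x : V := nth x [seq y <- nbr x | (tdist r y).+1 == tdist r x] 0.

Lemma parP r x : x != r -> t x (par r x) /\ (tdist r (par r x)).+1 = tdist r x.
Proof.
move=> xr; have [y txy yx] := tree_parent xr.
suff : par r x \in [seq y <- nbr x | (tdist r y).+1 == tdist r x].
  by rewrite mem_filter mem_nbr => /andP[/eqP].
by apply: mem_nth; rewrite size_filter -has_count; apply/hasP; exists y; rewrite ?mem_nbr ?yx.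
Qed.

Lemma par_edge r x y : t x y -> tdist r y = (tdist r x).+1 -> par r y = x.
Proof.
move=> txy yx; have yr : y != r by rewrite -tdist_eq0 yx.
have [typ py] := parP yr.
apply: (@tree_unique_parent r y) => //; [by rewrite tree_sym|by rewrite -py|by rewrite yx].
Qed.

(** * Locally injective endomorphisms of the tree *)

Section covering.
Variable s : V -> V.
Hypothesis s_hom : forall x y, t x y -> t (s x) (s y).
Hypothesis s_inj : forall x y z, t x y -> t x z -> s y = s z -> y = z.

(** Induction on depth: if the image of [x] came closer to the image of [r] than that of the parent
    of [x], it would be the image of the grandparent, against injectivity around the parent. *)
Lemma covering_tdist r x : tdist (s r) (s x) = tdist r x.
Proof.
move En : (tdist r x) => n; elim/ltn_ind: n x En => n IHn x En.
have [xr|xr] := eqVneq x r; first by rewrite -En xr !tdistxx.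
have [txp px] := parP xr; set p := par r x in txp px.
have sp : tdist (s r) (s p) = tdist r p by apply: IHn => //; rewrite -En -px.
have := tdist_edge (s r) (s_hom txp); rewrite sp -En -px => -[] // E.
have [pr|pr] := eqVneq p r; first by move: E; rewrite pr tdistxx.
have [tpq qp] := parP pr; set q := par r p in tpq qp.
have sq : tdist (s r) (s q) = tdist r q by apply: IHn => //; rewrite -En -px -qp leqnSn.
suff xq : x = q by move: px; rewrite -qp xq => /eqP; rewrite eqn_leq ltnNge leqnSn.
apply: (@s_inj p) => //; first by rewrite tree_sym.
apply: (@tree_unique_parent (s r) (s p)).
- by rewrite tree_sym; exact: s_hom.
- exact: s_hom.
- by rewrite sp E leqnSn.
- by rewrite sp sq -qp leqnSn.
Qed.

Lemma covering_nbr x : perm_eq (map s (nbr x)) (nbr (s x)).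
Proof.
have us : uniq (map s (nbr x)).
  rewrite map_inj_in_uniq ?nbr_uniq// => y z; rewrite !mem_nbr; exact: s_inj.
have sub : {subset map s (nbr x) <= nbr (s x)}.
  by move=> _ /mapP[y + ->]; rewrite !mem_nbr; exact: s_hom.
have [|_ E] := uniq_min_size us sub; first by rewrite size_map !size_nbr.
by apply: uniq_perm; rewrite ?nbr_uniq.
Qed.

(** Injectivity comes from preservation of distances, surjectivity from lifting walks. *)
Lemma covering_automorphism : automorphism t s.
Proof.
have inj : injective s.
  move=> x y sxy; apply/eqP; rewrite -tdist_eq0.
  by rewrite -(covering_tdist y x) sxy tdistxx.
have lift x y : t (s x) y -> exists2 z, t x z & s z = y.
  rewrite -mem_nbr -(perm_mem (covering_nbr x)) => /mapP[z].
  by rewrite mem_nbr => txz ->; exists z.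
have walk p : forall a, path t (s a) p -> exists x, s x = last (s a) p.
  elim: p => [a _|z p IHp a /= /andP[/lift[b _ <-]]]; last exact: IHp.
  by exists a.
have surj y : exists x, s x = y.
  by case: ht => _ _ /(_ (s y) y)[p /walk + <-].
split; first exact: (Bijective (g := fun y => projT1 (cid (surj y)))
   (fun x => inj _ _ (projT2 (cid (surj (s x))))) (fun y => projT2 (cid (surj y)))).
move=> x y; apply/idP/idP; last exact: s_hom.
by move=> /lift[z txz /inj <-].
Qed.

End covering.

(** * Matching the neighbours of two vertices *)

Definition swap (a b z : V) : V := if z == a then b else if z == b then a else z.

Lemma swap_inj a b : injective (swap a b).
Proof.
move=> x y; rewrite /swap.
case: (eqVneq x a) => [->|xa]; case: (eqVneq y a) => [->//|ya].
- by case: eqVneq => [->//|yb] E; rewrite E eqxx in yb.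
- by case: eqVneq => [->//|xb] E; rewrite E eqxx in xb.
- case: (eqVneq x b) => [->|xb]; case: (eqVneq y b) => [->//|yb] //.
  + by move=> E; rewrite E eqxx in ya.
  + by move=> E; rewrite E eqxx in xa.
Qed.

Lemma swapxx a z : swap a a z = z.
Proof. by rewrite /swap; case: eqVneq. Qed.

Lemma swapl a b : swap a b a = b.
Proof. by rewrite /swap eqxx. Qed.

Lemma swap_nbr x a b z : t x a -> t x b -> t x z -> t x (swap a b z).
Proof. by move=> xa xb xz; rewrite /swap; do 2 (case: ifP => // _). Qed.

(** Neighbours are matched by their position in the lists. The separate case makes the map the
    identity at every [z], also off the neighbours of [x]. *)
Definition nbr_map x y z : V := if x == y then z else nth y (nbr y) (index z (nbr x)).

Lemma nbr_map_nbr x y z : t x z -> t y (nbr_map x y z).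
Proof.
rewrite /nbr_map; case: eqP => [->//|_] txz.
by rewrite -mem_nbr mem_nth // size_nbr -(size_nbr x) index_mem mem_nbr.
Qed.

Lemma nbr_map_inj x y z z' : t x z -> t x z' -> nbr_map x y z = nbr_map x y z' -> z = z'.
Proof.
rewrite /nbr_map; case: eqP => [//|_] txz txz' /eqP.
rewrite nth_uniq ?nbr_uniq ?size_nbr -?(size_nbr x) ?index_mem ?mem_nbr// => /eqP E.
by rewrite -(@nth_index _ x z (nbr x)) ?mem_nbr// E nth_index ?mem_nbr.
Qed.

(** The transposition corrects the matching by position so that [p] goes to [q]. *)
Definition nbr_match p x q y z : V := swap (nbr_map x y p) q (nbr_map x y z).

Lemma nbr_match_nbr p x q y z : t x p -> t y q -> t x z -> t y (nbr_match p x q y z).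
Proof.
by move=> txp tyq txz; apply: swap_nbr => //; exact: nbr_map_nbr.
Qed.

Lemma nbr_match_inj p x q y z z' : t x z -> t x z' ->
  nbr_match p x q y z = nbr_match p x q y z' -> z = z'.
Proof. by move=> xz xz' /swap_inj; exact: nbr_map_inj. Qed.

Lemma nbr_match_l p x q y : nbr_match p x q y p = q.
Proof. exact: swapl. Qed.

Lemma nbr_match_id p x z : nbr_match p x p x z = z.
Proof. by rewrite /nbr_match /nbr_map eqxx swapxx. Qed.

(** * The automorphism exchanging two children *)

Section child_swap.
Variables v u w w' : V.
Hypotheses (tuw : t u w) (tuw' : t u w').
Hypothesis wu : tdist v w = (tdist v u).+1.
Hypothesis wu' : tdist v w' = (tdist v u).+1.

(* The value at a vertex of depth [n] below the root [v] of the automorphism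
   that fixes the ball of radius [tdist v u], swaps [w] and [w'], and is
   extended downwards by matching the neighbours of [x] with those of its
   image, parent to parent. *)
Fixpoint child_swap_rec (n : nat) (x : V) : V :=
  if n is m.+1 then
    if n <= tdist v u then x
    else if par v x == u then swap w w' x
    else if m is l.+1 then
      nbr_match (par v (par v x)) (par v x)
        (child_swap_rec l (par v (par v x))) (child_swap_rec m (par v x)) x
    else x
  else x.

Definition child_swap x := child_swap_rec (tdist v x) x.

Lemma child_swap_top x : tdist v x <= tdist v u -> child_swap x = x.
Proof. by rewrite /child_swap; case: (tdist v x) => //= n ->. Qed.

Lemma child_swap_u x : t u x -> tdist v x = (tdist v u).+1 ->
  child_swap x = swap w w' x.
Proof. by move=> tux xu; rewrite /child_swap xu /= ltnn (par_edge tux)// eqxx. Qed.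

(** In the fixed ball the matching is the identity, so the recursion reads the same there as below
    it. The exceptions are [u], whose children are exchanged, and the root, which has no parent. *)
Lemma child_swap_step x y : x != u -> x != v -> t x y ->
  tdist v y = (tdist v x).+1 ->
  child_swap y = nbr_match (par v x) x (child_swap (par v x)) (child_swap x) y.
Proof.
move=> xu xv txy yx; have [txp px] := parP xv.
have [yu|yu] := leqP (tdist v y) (tdist v u).
  rewrite !child_swap_top ?nbr_match_id//; move: yu; rewrite yx -?px.
  - exact: ltnW.
  - by move=> /ltnW/ltnW.
rewrite /child_swap yx -px /= px -yx leqNgt yu /= (par_edge txy)// (negbTE xu).
by rewrite -px.
Qed.

(** Adjacency of these two images is what lets the matching around [x] send parent to parent. *)
Lemma child_swap_parent x : x != v -> t (child_swap (par v x)) (child_swap x).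
Proof.
move En : (tdist v x) => n; elim: n x En => [|n IHn] x En xv.
  by rewrite -tdist_eq0 En in xv.
have [txp px] := parP xv; have tpx : t (par v x) x by rewrite tree_sym.
have [pu|pu] := eqVneq (par v x) u.
  rewrite [in child_swap (par v x)]pu (@child_swap_top u)//; rewrite pu in px tpx.
  by rewrite child_swap_u//; exact: swap_nbr.
have [pv|pv] := eqVneq (par v x) v.
  have u0 : 0 < tdist v u by rewrite lt0n tdist_eq0 -pv eq_sym.
  by rewrite !child_swap_top// -?px pv tdistxx.
rewrite (child_swap_step pu pv tpx (esym px)); apply: nbr_match_nbr => //.
  exact: (parP pv).1.
by rewrite tree_sym; apply: IHn => //; move: px; rewrite En => -[].
Qed.

(** A single local map [g] treats parent and children together, so the covering hypotheses reduce to
    three cases: [u], the root, and the other vertices. *)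
Lemma child_swap_nbr x : exists g : V -> V,
  [/\ forall y, t x y -> child_swap y = g y,
      forall y, t x y -> t (child_swap x) (g y) &
      forall y z, t x y -> t x z -> g y = g z -> y = z].
Proof.
have [->|xu] := eqVneq x u.
  exists (swap w w'); split=> [y tuy|y|y z _ _ /swap_inj//].
    have [/(child_swap_u tuy)//|yu] := tdist_edge v tuy.
    (* The parent of [u] is neither [w] nor [w'], by its depth, so the transposition fixes it. *)
    rewrite child_swap_top ?yu// /swap; case: eqVneq => [E|_].
      by move: yu; rewrite E wu; lia.
    by case: eqVneq => // E; move: yu; rewrite E wu'; lia.
  by rewrite child_swap_top//; exact: swap_nbr.
have [xv|xv] := eqVneq x v.
  (* As [u] is not the root, all neighbours of the root lie in the fixed ball. *)
  have u0 : 0 < tdist v u by rewrite lt0n tdist_eq0 eq_sym -xv.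
  rewrite xv.
  exists id; split=> // y tvy; last by rewrite child_swap_top ?tdistxx.
  by rewrite child_swap_top// (leq_trans (tdist_le _ tvy))// tdistxx.
exists (nbr_match (par v x) x (child_swap (par v x)) (child_swap x)).
have [txp px] := parP xv; split=> [y txy|y txy|y z].
- have [/(child_swap_step xu xv txy)//|yx] := tdist_edge v txy.
  have -> : y = par v x.
    by apply: (@tree_unique_parent v x) => //; [rewrite yx|rewrite -px].
  by rewrite nbr_match_l.
- by apply: nbr_match_nbr => //; rewrite tree_sym; exact: child_swap_parent.
- exact: nbr_match_inj.
Qed.

Lemma child_swap_automorphism : automorphism t child_swap.
Proof.
apply: covering_automorphism => [x y txy|x y z txy txz].
  by have [g [E h _]] := child_swap_nbr x; rewrite (E y)// h.
by have [g [E _ i]] := child_swap_nbr x; rewrite (E y)// (E z)//; exact: i.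
Qed.

End child_swap.

Lemma tree_child_transitive v u w w' : t u w -> t u w' ->
  tdist v w = (tdist v u).+1 -> tdist v w' = (tdist v u).+1 ->
  exists a, [/\ automorphism t a, a v = v & a w = w'].
Proof.
move=> tuw tuw' wu wu'; exists (child_swap v u w w'); split.
- exact: child_swap_automorphism.
- by rewrite child_swap_top// tdistxx.
- by rewrite child_swap_u// swapl.
Qed.

End tree.

Local Open Scope ring_scope.

(** * Chebyshev bound for the non-backtracking polynomials *)

Section chebyshev.
Context {A : comNzRingType}.
Variable y : A.

(* [chebT n] is [T_n(y)] and [chebW n] is [U_{n-1}(y)], with [U_{-1} = 0]. *)
Fixpoint cheb (n : nat) : A * A :=
  if n is m.+1 then
    (y * (cheb m).1 - (1 - y ^+ 2) * (cheb m).2, y * (cheb m).2 + (cheb m).1)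
  else (1, 0).

Definition chebT n := (cheb n).1.
Definition chebW n := (cheb n).2.

Lemma chebTS n : chebT n.+1 = y * chebT n - (1 - y ^+ 2) * chebW n.
Proof. by []. Qed.

Lemma chebWS n : chebW n.+1 = y * chebW n + chebT n.
Proof. by []. Qed.

(** The recursion multiplies [T + i sqrt(1-y^2) W] by [y + i sqrt(1-y^2)], which has norm 1. *)
Lemma cheb_pell n : chebT n ^+ 2 + (1 - y ^+ 2) * chebW n ^+ 2 = 1.
Proof.
elim: n => [|n IHn]; first by rewrite /chebT /chebW /=; ring.
by rewrite chebTS chebWS -[RHS]IHn; ring.
Qed.

Lemma chebTSS n : chebT n.+2 = 2 * y * chebT n.+1 - chebT n.
Proof. by rewrite chebTS chebWS !chebTS; ring. Qed.

Lemma chebWSS n : chebW n.+2 = 2 * y * chebW n.+1 - chebW n.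
Proof. by rewrite !chebWS chebTS; ring. Qed.

Lemma chebWSS_T n : chebW n.+2 = chebW n + 2 * chebT n.+1.
Proof. by rewrite !chebWS chebTS; ring. Qed.

End chebyshev.

(** Two consecutive polynomials are carried along because the recurrence has order two. *)
Fixpoint nb_poly2 {R : fieldType} (d : nat) (k : nat) : {poly R} * {poly R} :=
  if k is m.+1 then
    let: (p, q) := nb_poly2 d m in (q, (d%:R - 1)^-1 *: ('X * q - p))
  else (1, d%:R^-1 *: 'X).

(* On the [d]-regular tree, the mean over the sphere of radius [k] is
   [nb_poly d k] evaluated at the adjacency operator. *)
Definition nb_poly {R : fieldType} (d k : nat) : {poly R} := (nb_poly2 d k).1.

Section nb_poly.
Context {R : fieldType} (d : nat).
Local Notation q := (@nb_poly R d).

Lemma nb_poly0 : q 0 = 1. Proof. by []. Qed.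

Lemma nb_poly1 : q 1 = d%:R^-1 *: 'X. Proof. by []. Qed.

Lemma nb_polySS k : q k.+2 = (d%:R - 1)^-1 *: ('X * q k.+1 - q k).
Proof. by rewrite /nb_poly /=; case: (nb_poly2 d k). Qed.

(** Multiplication by [s^n d] turns the recurrence of [q] into the Chebyshev one, so agreement at
    two consecutive indices suffices. Indices start at 1 to keep that of [chebW] nonnegative. *)
Lemma nb_poly_cheb (s : R) k : d%:R != 0 :> R -> s ^+ 2 = d%:R - 1 -> s != 0 ->
  2 != 0 :> R ->
  let y := (2 * s)^-1 *: 'X in
  (s ^+ k.+1 * d%:R) *: q k.+1 =
  (2 * (d%:R - 1)) *: chebT y k.+1 + (d%:R - 2) *: chebW y k.
Proof.
move=> d0 sd s0 two0 y.
have sd1 : d%:R = s ^+ 2 + 1 by rewrite sd subrK.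
have two : 2 = 2%:P :> {poly R} by rewrite polyCMn.
have Xy : 'X = 2 * s%:P * y.
  by rewrite two -polyCM mul_polyC scalerA mulfV ?scale1r // mulf_neq0.
have D1 : d%:R%:P * q 1 = 'X.
  by rewrite nb_poly1 mul_polyC scalerA mulfV ?scale1r.
have D2 n : s%:P ^+ 2 * q n.+2 = 'X * q n.+1 - q n.
  by rewrite nb_polySS -sd -polyC_exp mul_polyC scalerA mulfV ?scale1r ?expf_neq0.
have Dd : d%:R%:P = s%:P ^+ 2 + 1 :> {poly R} by rewrite -polyC_exp -polyCD -sd1.
pose a n := s%:P ^+ n * d%:R%:P * q n.
pose b n := 2 * s%:P ^+ 2 * chebT y n.+1 + (s%:P ^+ 2 - 1) * chebW y n.
have aSS n : a n.+3 = 2 * y * a n.+2 - a n.+1.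
  transitivity (s%:P ^+ n.+1 * d%:R%:P * (s%:P ^+ 2 * q n.+3)).
    by rewrite /a !exprS; ring.
  by rewrite D2 Xy /a !exprS; ring.
have bSS n : b n.+2 = 2 * y * b n.+1 - b n.
  by rewrite /b chebTSS chebWSS; ring.
have ab : a k.+1 = b k.
  suff [] : a k.+1 = b k /\ a k.+2 = b k.+1 by [].
  elim: k => [|k [IH1 IH2]]; last by rewrite aSS bSS IH1 IH2.
  split.
    transitivity (s%:P * (d%:R%:P * q 1)); first by rewrite /a; ring.
    by rewrite D1 Xy /b !chebTS /chebT /chebW /=; ring.
  transitivity (d%:R%:P * (s%:P ^+ 2 * q 2)); first by rewrite /a; ring.
  transitivity ('X * (d%:R%:P * q 1) - d%:R%:P).
    by rewrite D2 nb_poly0; ring.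
  by rewrite D1 Xy Dd /b !chebTS !chebWS /chebT /chebW /=; ring.
rewrite -!mul_polyC -sd !polyCM polyC_exp -[LHS]/(a k.+1) ab /b -two.
by rewrite sd1 polyCB polyCD polyC_exp -two polyC1; ring.
Qed.

End nb_poly.

(** * Bounds for positive functionals on polynomials *)

Section bound.
Context {R : realFieldType} (d : nat).
Variable (s : R) (L : {scalar {poly R}}).
Hypothesis L_ge0 : forall P, 0 <= L (P * P).
Hypothesis L_bound : forall P, L ('X * P * ('X * P)) <= (2 * s) ^+ 2 * L (P * P).
Hypothesis s_gt0 : 0 < s.

Local Notation y := ((2 * s)^-1 *: 'X : {poly R}).

(** Pell's identity and [L_bound] give [L (T^2) <= L 1]; positivity on [(1 + T)^2] and [(1 - T)^2]
    then bounds [L T] on both sides. *)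
Lemma functional_chebT n : `|L (chebT y n)| <= L 1.
Proof.
have Ly P : L (y * P * (y * P)) <= L (P * P).
  have -> : y * P * (y * P) = ((2 * s) ^- 2) *: ('X * P * ('X * P)).
    by rewrite -!scalerAl -!scalerAr scalerA -invfM expr2.
  rewrite linearZ /= ler_pdivrMl ?L_bound// exprn_gt0// mulr_gt0//.
have LT : L (chebT y n * chebT y n) <= L 1.
  rewrite -(cheb_pell y n) -expr2 raddfD /= lerDl.
  have -> : (1 - y ^+ 2) * chebW y n ^+ 2
    = chebW y n * chebW y n - (y * chebW y n) * (y * chebW y n) by ring.
  by rewrite raddfB /= subr_ge0.
have Lp := L_ge0 (1 + chebT y n); have Lm := L_ge0 (1 - chebT y n).
have Ep : (1 + chebT y n) * (1 + chebT y n) =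
    1 + chebT y n + chebT y n + chebT y n * chebT y n by ring.
have Em : (1 - chebT y n) * (1 - chebT y n) =
    1 - chebT y n - chebT y n + chebT y n * chebT y n by ring.
move: Lp Lm; rewrite Ep Em !(raddfD, raddfB) /= ler_norml; lra.
Qed.

(** Raising the index by two adds [2 T], at a cost of at most [2 L 1]; hence the joint induction on
    [n] and [n.+1]. *)
Lemma functional_chebW n : `|L (chebW y n)| <= n%:R * L 1.
Proof.
suff: `|L (chebW y n)| <= n%:R * L 1 /\ `|L (chebW y n.+1)| <= n.+1%:R * L 1.
  by case.
elim: n => [|n [IH1 IH2]].
  by rewrite mul0r mul1r chebWS /chebT /chebW /= mulr0 add0r raddf0 normr0;
    split=> //; have := functional_chebT 0.
split=> //; rewrite chebWSS_T; move: IH1 (functional_chebT n.+1).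
set w := chebW _ n; set u := chebT _ n.+1 => IH1 Lu.
have -> : 2 * u = u + u by ring.
by move: IH1 Lu; rewrite !raddfD /= -!natr1 !mulrDl mul1r !ler_norml; lra.
Qed.

Lemma functional_nb_poly k : (2 <= d)%N -> s ^+ 2 = d%:R - 1 ->
  `|L (nb_poly d k)| <=
  (k%:R + 1 - 2 * k%:R / d%:R) * (1 / s) ^+ k * L 1.
Proof.
move=> d2 sd; have dR : 2 <= d%:R :> R by rewrite ler_nat.
have d0 : 0 < d%:R :> R by lra.
case: k => [|k].
  rewrite nb_poly0 !mulr0 mul0r add0r subr0 expr0 mulr1 mul1r ger0_norm //.
  by have := L_ge0 1; rewrite mulr1.
have sk : 0 < s ^+ k.+1 * d%:R by rewrite mulr_gt0// exprn_gt0.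
rewrite -(ler_pM2l sk) -[X in X * `|_|](gtr0_norm sk) -normrM -linearZ /=.
rewrite nb_poly_cheb ?gt_eqF //.
rewrite [in leLHS]linearD ![in leLHS]linearZ /=.
(* The two coefficients of [nb_poly_cheb], the second weighted by the bound [k] for [chebW], add up
   to [d] times the linear factor of the claim at [k.+1]. *)
rewrite [leRHS](_ : _ = (2 * (d%:R - 1) + (d%:R - 2) * k%:R) * L 1); last first.
  by rewrite -natr1 expr_div_n expr1n; field; rewrite !gt_eqF // exprn_gt0.
rewrite [leRHS]mulrDl (le_trans (ler_normD _ _))// lerD// normrM.
  by rewrite ger0_norm ?ler_wpM2l ?functional_chebT//; lra.
by rewrite -mulrA ger0_norm ?ler_wpM2l ?functional_chebW//; lra.
Qed.

End bound.

(** * Lower integrals and measurability up to null sets *)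

Section lower_integral.
Context dd (T : measurableType dd) (R : realType).
Variable mu : {measure set T -> \bar R}.
Local Open Scope ereal_scope.

(** The integral of a nonnegative function is a supremum over the simple functions below it, so it
    is monotone even without measurability. *)
Lemma ge0_le_lower_integral (f g : T -> \bar R) : (forall x, 0 <= f x) ->
  (forall x, f x <= g x) -> \int[mu]_x f x <= \int[mu]_x g x.
Proof.
move=> f0 fg; have g0 x : 0 <= g x by exact: le_trans (fg x).
rewrite !ge0_integralTE//; apply: ereal_sup_le => _ [h hf <-].
by exists h => // x; exact: le_trans (fg x).
Qed.

(** Simple functions below [f] with integrals within [1/(n+1)] of the supremum are merged into their
    pointwise supremum. *)
Lemma lower_integral_attained (f : T -> \bar R) : (forall x, 0 <= f x) ->
  \int[mu]_x f x \is a fin_num ->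
  exists l : T -> \bar R, [/\ measurable_fun setT l, forall x, 0 <= l x, forall x, l x <= f x &
    \int[mu]_x l x = \int[mu]_x f x].
Proof.
move=> f0 ffin.
have ex n : exists h : {nnsfun T >-> R}, (forall x, (h x)%:E <= f x) /\
    \int[mu]_x f x - (n.+1%:R^-1)%:E <= \int[mu]_x (h x)%:E.
  move: ffin; rewrite ge0_integralTE// => ffin.
  have n0 : (0 < n.+1%:R^-1 :> R)%R by rewrite invr_gt0.
  have [_ [h hf <-] H] := ub_ereal_sup_adherent n0 ffin.
  by exists h; split=> //; rewrite integralT_nnsfun ltW.
have [h hP] := choice ex.
pose l x := esups (fun n => (h n x)%:E) 0%N.
have hl n x : (h n x)%:E <= l x by apply: ereal_sup_ubound; exists n.
have l0 x : 0 <= l x by apply: le_trans (hl 0%N x); rewrite lee_fin.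
have lf x : l x <= f x.
  by apply: ge_ereal_sup => _ [n _ <-]; exact: (hP n).1.
exists l; split=> //.
  by apply: measurable_fun_esups => n; exact/measurable_EFinP.
apply/eqP; rewrite eq_le ge0_le_lower_integral//=.
apply/lee_addgt0Pr => e e0.
have [n ne] : exists n, (n.+1%:R^-1 < e)%R.
  by have [n _ /(_ n (leqnn n))] := near_infty_natSinv_lt (PosNum e0); exists n.
have := (hP n).2; rewrite leeBlDr// => /le_trans; apply.
apply: leeD; last by rewrite lee_fin ltW.
by apply: ge0_le_lower_integral => [x|//]; rewrite lee_fin.
Qed.

End lower_integral.

Section ae_measurable.
Context dd (T : measurableType dd) (R : realType) (mu : {measure set T -> \bar R}).

(* Measurability for the completion of [mu]. *)
Definition ae_measurable (f : T -> R) : Prop :=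
  exists2 g : T -> R, measurable_fun setT g & {ae mu, forall x, f x = g x}.

Lemma ae_measurable_fun f : measurable_fun setT f -> ae_measurable f.
Proof. by move=> mf; exists f => //; apply: aeW. Qed.

Lemma ae_measurableD f g : ae_measurable f -> ae_measurable g ->
  ae_measurable (fun x => f x + g x).
Proof.
move=> [f' mf' ff'] [g' mg' gg']; exists (fun x => f' x + g' x).
  exact: measurable_funD.
by apply: filterS2 ff' gg' => x -> ->.
Qed.

Lemma ae_measurableZ (c : R) f : ae_measurable f -> ae_measurable (fun x => c * f x).
Proof.
move=> [f' mf' ff']; exists (fun x => c * f' x).
  exact: measurable_funM.
by apply: filterS ff' => x ->.
Qed.

Lemma ae_measurable_sum (I : Type) (s : seq I) (F : I -> T -> R) :
  (forall i, ae_measurable (F i)) -> ae_measurable (fun x => \sum_(i <- s) F i x).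
Proof.
move=> H; elim: s => [|i s IH].
  by under eq_fun do rewrite big_nil; exact: ae_measurable_fun.
by under eq_fun do rewrite big_cons; exact: ae_measurableD.
Qed.

(** The exceptional null sets are merged into one, on which the limit is replaced by 0. *)
Lemma ae_measurable_lim (F : nat -> T -> R) f : (forall n, ae_measurable (F n)) ->
  (forall x, F n x @[n --> \oo] --> f x) -> ae_measurable f.
Proof.
move=> HF Ff; have [G GP] := choice (fun n => (exists2P _ _).1 (HF n)).
have [N [mN N0 NS]] := ae_foralln (fun n => (GP n).2).
have FG x n : ~ N x -> F n x = G n x.
  by move=> Nx; have := contra_not (NS x) Nx; rewrite /= notK.
exists (f \_ (~` N)).
  apply: (@measurable_fun_cvg _ _ _ _ (fun n => G n \_ (~` N))) => [n|x _].
    apply/(measurable_restrictT _ (measurableC mN)).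
    exact: measurable_funS (GP n).1.
  rewrite /patch; case: ifPn => [|_]; last exact: cvg_cst.
  by rewrite inE => Nx; under eq_cvg do rewrite -FG//; exact: Ff.
exists N; split=> // x /= fx; apply: contrapT => Nx; apply: fx.
by rewrite patchE mem_set.
Qed.

(** Cutting [g] to 0 on a null set keeps its integral and leaves a function below [f]. The integral
    of [f] is only a lower integral here. *)
Lemma le_lower_integral_ae (f g : T -> R) : measurable_fun setT g ->
  (forall x, 0 <= g x) -> (forall x, 0 <= f x) -> {ae mu, forall x, f x = g x} ->
  (\int[mu]_x (g x)%:E <= \int[mu]_x (f x)%:E)%E.
Proof.
move=> mg g0 f0 [N [mN N0 NS]].
have mg' : measurable_fun setT (fun x => (g x)%:E) by exact/measurable_EFinP.
rewrite (@ge0_negligible_integral _ _ _ mu setT N)//; first last.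
- by move=> x _; rewrite lee_fin.
rewrite setTD integral_mkcond; apply: ge0_le_lower_integral => x.
  by apply: erestrict_ge0 => y _; rewrite lee_fin.
rewrite patchE; case: ifPn; last by rewrite lee_fin.
by rewrite inE => Nx; have /= := contra_not (NS x) Nx; rewrite notK => ->.
Qed.

End ae_measurable.

Section ae_measurable_probability.
Context dd (T : measurableType dd) (R : realType) (mu : probability T R).

(* The second hypothesis says that the upper integral of [f] is also [a]. *)
Lemma ae_measurable_lower_upper (f : T -> R) (M a : R) :
  (forall x, 0 <= f x <= M) -> (\int[mu]_x (f x)%:E = a%:E)%E ->
  (\int[mu]_x (M - f x)%:E = (M - a)%:E)%E -> ae_measurable mu f.
Proof.
move=> f0M fa fMa.
have f0 x : (0 <= (f x)%:E)%E by rewrite lee_fin; case/andP: (f0M x).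
have fM x : (0 <= (M - f x)%:E)%E by rewrite lee_fin subr_ge0; case/andP: (f0M x).
have [|l [ml l0 lf il]] := lower_integral_attained (mu := mu) f0; first by rewrite fa.
have [|r [mr r0 rf ir]] := lower_integral_attained (mu := mu) fM; first by rewrite fMa.
have lfin x : l x \is a fin_num by rewrite ge0_fin_numE// (le_lt_trans (lf x))// ltry.
have rfin x : r x \is a fin_num by rewrite ge0_fin_numE// (le_lt_trans (rf x))// ltry.
(* [D] is the gap between [l] and [M - r], which enclose [f]. It is nonnegative with integral zero,
   so [f = l] almost everywhere. *)
pose D x := (M%:E - (l x + r x))%E.
have D0 x : (0 <= D x)%E.
  rewrite /D sube_ge0 ?fin_numD ?lfin ?rfin// (le_trans (leeD (lf x) (rf x)))//.
  by rewrite -EFinD lee_fin addrC subrK.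
have mlr : measurable_fun setT (fun x => l x + r x)%E by exact: emeasurable_funD.
have mD : measurable_fun setT D by exact: emeasurable_funB.
have iD : (\int[mu]_x D x = 0)%E.
  have : (\int[mu]_x (D x + (l x + r x)) = M%:E)%E.
    under eq_integral do rewrite /D subeK ?fin_numD ?lfin ?rfin//.
    by rewrite integral_cst//= probability_setT mule1.
  rewrite ge0_integralD//; last by move=> x _; exact: adde_ge0.
  rewrite [X in (_ + X)%E]ge0_integralD// il ir fa fMa -EFinD subrKC.
  by move/(congr1 (fun z => z - M%:E)%E); rewrite addeK// subee.
have /(ae_eq_integral_abs mu measurableT mD) H : (\int[mu]_x `|D x| = 0)%E.
  by rewrite -iD; apply: eq_integral => x _; rewrite gee0_abs.
exists (fine \o l); first exact: measurableT_comp.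
apply: filterS H => x /(_ I); rewrite /D /= => Dx.
apply/eqP; rewrite eq_le; apply/andP; split; last first.
  by rewrite -lee_fin fineK.
rewrite -lee_fin fineK//.
have /eqP := Dx; rewrite sube_eq ?fin_numD ?lfin ?rfin ?fin_num_adde_defr// add0e => /eqP MD.
have := rf x; rewrite EFinB MD leeBrDr// addeC leeD2rE//.
Qed.

End ae_measurable_probability.

(** * Square-integrable functions and measure-preserving maps *)

Section L2.
Context dd (T : measurableType dd) (R : realType) (mu : probability T R).

Lemma Lnorm2_sqr (f : T -> R) :
  ('N[mu]_2%:E[EFin \o f] `^ 2 = \int[mu]_x (f x ^+ 2)%:E)%E.
Proof.
rewrite powR_Lnorm//; apply: eq_integral => x _.
by rewrite /= powR_mulrn// real_normK ?num_real.
Qed.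

(** This is applied to [graphing_op E h], which is measurable only up to a null set; the integral is
    then a lower integral. *)
Lemma Lnorm2_le (f : T -> R) (c : R) : 0 <= c ->
  ('N[mu]_2%:E[EFin \o f] <= c%:E)%E = (\int[mu]_x (f x ^+ 2)%:E <= (c ^+ 2)%:E)%E.
Proof.
move=> c0; rewrite -Lnorm2_sqr.
have := Lnorm_ge0 mu 2%:E (EFin \o f).
case: ('N[mu]_2%:E[EFin \o f])%E => [r| |]//= r0.
  by rewrite !lee_fin powR_mulrn// ler_pXn2r// nnegrE.
by rewrite pnatr_eq0 /= !leye_eq.
Qed.

Lemma Lfun2P (f : T -> R) : measurable_fun setT f ->
  (\int[mu]_x (f x ^+ 2)%:E < +oo)%E -> f \in Lfun mu 2%:E.
Proof.
move=> mf; rewrite -Lnorm2_sqr => /lty_poweRy H.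
by rewrite inE /=; apply/andP; split; rewrite inE//=; apply: H.
Qed.

Lemma Lfun_measurable p (f : T -> R) : f \in Lfun mu p -> measurable_fun setT f.
Proof. by rewrite inE => /andP[]; rewrite inE. Qed.

Lemma Lfun2_lin (a : R) f g : f \in Lfun mu 2%:E -> g \in Lfun mu 2%:E ->
  (fun x => a * f x + g x) \in Lfun mu 2%:E.
Proof. by have [_ H] := Lfun_submod_closed mu (lee1n 2); exact: H. Qed.

Lemma Lfun2_sum (I : Type) (s : seq I) (c : I -> R) (F : I -> T -> R) :
  (forall i, F i \in Lfun mu 2%:E) ->
  (fun x => \sum_(i <- s) c i * F i x) \in Lfun mu 2%:E.
Proof.
move=> F2; elim: s => [|i s IHs].
  by under eq_fun do rewrite big_nil; exact: Lfun_cst.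
by under eq_fun do rewrite big_cons; exact: Lfun2_lin.
Qed.

Lemma Lfun2_integrableM f g : f \in Lfun mu 2%:E -> g \in Lfun mu 2%:E ->
  mu.-integrable setT (EFin \o (fun x => f x * g x)).
Proof. by move=> f2 g2; apply/Lfun1_integrable; exact: Lfun2_mul_Lfun1. Qed.

Lemma Rintegral_sum (I : Type) (s : seq I) (F : I -> T -> R) :
  (forall i, mu.-integrable setT (EFin \o F i)) ->
  \int[mu]_x (\sum_(i <- s) F i x) = \sum_(i <- s) \int[mu]_x F i x.
Proof.
move=> iF; elim: s => [|i s IHs].
  by rewrite big_nil; under eq_Rintegral do rewrite big_nil; rewrite Rintegral_cst ?mul0r.
rewrite big_cons; under eq_Rintegral do rewrite big_cons.
rewrite RintegralD ?IHs//.
suff : mu.-integrable setT (fun x => \sum_(i <- s) (F i x)%:E)%E.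
  by apply: eq_integrable => // x _; rewrite /= sumEFin.
exact: (@integrable_sum _ _ _ mu _ measurableT _ s xpredT
  (fun i x => (F i x)%:E) (fun i _ => iF i)).
Qed.

Lemma Rintegral_ae_eq f g : measurable_fun setT f -> measurable_fun setT g ->
  {ae mu, forall x, f x = g x} -> \int[mu]_x f x = \int[mu]_x g x.
Proof.
move=> mf mg fg; rewrite /Rintegral; congr fine; apply: ae_eq_integral => //.
- exact/measurable_EFinP.
- exact/measurable_EFinP.
- by apply: filterS fg => x + _ => ->.
Qed.

End L2.

Section measure_preserving.
Context d1 d2 (T1 : measurableType d1) (T2 : measurableType d2) (R : realType).
Variables (m1 : probability T1 R) (m2 : probability T2 R) (phi : T1 -> T2).
Hypothesis mphi : measurable_fun setT phi.
Hypothesis phi_preserving : forall A, measurable A -> m1 (phi @^-1` A) = m2 A.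

Lemma integral_measure_preserving (f : T2 -> \bar R) : measurable_fun setT f ->
  (\int[m1]_x f (phi x) = \int[m2]_y f y)%E.
Proof.
have ge0 (g : T2 -> \bar R) : measurable_fun setT g -> (forall y, 0 <= g y)%E ->
    (\int[m1]_x g (phi x) = \int[m2]_y g y)%E.
  move=> mg g0.
  rewrite -[LHS](ge0_integral_pushforward mphi m1 measurableT mg) //.
  by apply: eq_measure_integral => A mA _; exact: phi_preserving.
move=> mf; rewrite -[LHS]/(\int[m1]_x (f \o phi) x)%E integralE [RHS]integralE.
rewrite -(ge0 (f^\+)%E) ?funepos_ge0//; last exact: measurable_funepos.
rewrite -(ge0 (f^\-)%E) ?funeneg_ge0//; last exact: measurable_funeneg.
congr (_ - _)%E; apply: eq_integral => x _; first by rewrite funepos_comp.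
by rewrite funeneg_comp.
Qed.

Lemma Rintegral_measure_preserving (f : T2 -> R) : measurable_fun setT f ->
  \int[m1]_x f (phi x) = \int[m2]_y f y.
Proof.
move=> mf; rewrite /Rintegral; congr fine.
by rewrite -(integral_measure_preserving (f := EFin \o f))//; exact/measurable_EFinP.
Qed.

Lemma Lfun2_measure_preserving (f : T2 -> R) :
  f \in Lfun m2 2%:E -> (f \o phi) \in Lfun m1 2%:E.
Proof.
move=> f2; have mf := Lfun_measurable f2.
apply: Lfun2P; first exact: measurableT_comp.
rewrite (integral_measure_preserving (f := fun y => (f y ^+ 2)%:E)); last first.
  by apply/measurable_EFinP; exact: measurable_funX.
have /(integrable_fin_num measurableT) := Lfun2_integrable_sqr f2.
by rewrite fin_numE ltey => /andP[].
Qed.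

Lemma ae_measure_preserving (P : T2 -> Prop) :
  {ae m2, forall y, P y} -> {ae m1, forall x, P (phi x)}.
Proof.
move=> [N [mN N0 NP]]; exists (phi @^-1` N); split=> [||x /= /NP//].
  by rewrite -[X in measurable X]setTI; exact: mphi.
by rewrite phi_preserving.
Qed.

End measure_preserving.

(** * The graphing operator *)

Lemma counting_seq (T : choiceType) (R : realType) (s : seq T) (B : set T) : uniq s ->
  counting ([set` s] `&` B) = (\sum_(y <- s) \1_B y)%:E :> \bar R.
Proof.
move=> us; set A := _ `&` B.
have AE : A = [set` [seq y <- s | y \in B]].
  apply/seteqP; split=> y; rewrite /A /= mem_filter.
    by move=> [-> By]; rewrite mem_set.
  by move=> /andP[]; rewrite inE.
have finA : finite_set A by rewrite AE; exact: finite_seq.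
rewrite /counting asboolT//; congr EFin.
rewrite -sum1_size natr_sum -fsbig_finite// AE -fsbig_seq ?filter_uniq//.
by rewrite big_filter big_mkcond; apply: eq_bigr => y _; rewrite indicE; case: ifP.
Qed.

Section graphing_op.
Context {R : realType} {X : ptopologicalType} {d : nat}.
Context {nu : probability (borel X) R} {E : set (X * X)}.
Hypothesis hreg : regular_graphing d nu E.

Lemma regular_graphing_nbr x :
  exists s : seq X, [/\ uniq s, size s = d & neighbors E x = [set` s]].
Proof. exact: card_eq_uniq_seq (hreg.2 x). Qed.

Definition gnbr x : seq X := projT1 (cid (regular_graphing_nbr x)).

Lemma gnbr_uniq x : uniq (gnbr x).
Proof. by rewrite /gnbr; case: cid => s []. Qed.

Lemma size_gnbr x : size (gnbr x) = d.
Proof. by rewrite /gnbr; case: cid => s []. Qed.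

Lemma neighborsE x : neighbors E x = [set` gnbr x].
Proof. by rewrite /gnbr; case: cid => s []. Qed.

Lemma graphing_opE (f : X -> R) x : graphing_op E f x = \sum_(y <- gnbr x) f y.
Proof. by rewrite /graphing_op neighborsE -fsbig_seq ?gnbr_uniq. Qed.

Lemma edges_toE x B : edges_to E x B = (graphing_op E \1_B x)%:E :> \bar R.
Proof. by rewrite /edges_to neighborsE counting_seq ?gnbr_uniq// graphing_opE. Qed.

Lemma graphing_op_cst (c : R) x : graphing_op E (fun=> c) x = d%:R * c.
Proof. by rewrite graphing_opE big_const_seq count_predT size_gnbr iter_addr_0 mulr_natl. Qed.

Lemma graphing_op_indic_setC B x :
  graphing_op E \1_(~` B) x = d%:R - graphing_op E \1_B x :> R.
Proof.
rewrite -[d%:R]mulr1 -(graphing_op_cst 1 x) !graphing_opE -sumrB.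
apply: eq_bigr => y _; rewrite !indicE in_setC.
by case: (y \in B); rewrite ?subrr ?subr0.
Qed.

(** The edges between the whole space and [B] are counted from the side of [B], where each vertex
    has [d] of them. *)
Lemma integral_graphing_op_indic (B : set (borel X)) : measurable B ->
  (\int[nu]_x (graphing_op E \1_B x)%:E = (d%:R * fine (nu B))%:E)%E.
Proof.
move=> mB; under eq_integral do rewrite -edges_toE.
rewrite (graphing_preserving hreg.1)//.
under eq_integral do rewrite edges_toE indicT graphing_op_cst mulr1.
by rewrite integral_cst// EFinM fineK// fin_num_measure.
Qed.

(* Applied to [B] and to its complement, [graphing_preserving] with [A] the
   whole space makes the lower and upper integrals of [edges_to E ^~ B] agree;
   this replaces the Lusin-Novikov theorem. *)
Lemma graphing_op_indic_ae_measurable (B : set (borel X)) : measurable B ->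
  ae_measurable nu (graphing_op E \1_B : X -> R).
Proof.
move=> mB; apply: (@ae_measurable_lower_upper _ _ _ _ _ d%:R (d%:R * fine (nu B))).
- move=> x; rewrite -[_ <= d%:R]subr_ge0 -graphing_op_indic_setC !graphing_opE.
  by rewrite !sumr_ge0.
- exact: integral_graphing_op_indic.
- under eq_integral do rewrite -graphing_op_indic_setC.
  rewrite integral_graphing_op_indic; last exact: measurableC.
  rewrite probability_setC// fineB ?fin_num_measure//= mulrBr mulr1//.
Qed.

(** At each point the operator is a finite sum, so it commutes with the approximation of [f] by
    simple functions and with their expansion in indicators. *)
Lemma graphing_op_ae_measurable (f : X -> R) :
  measurable_fun (setT : set (borel X)) f -> ae_measurable nu (graphing_op E f).
Proof.
move=> mf.
have mf' : measurable_fun (setT : set (borel X)) (EFin \o f) by exact/measurable_EFinP.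
have [s sf] := approximation_sfun measurableT mf'.
apply: (@ae_measurable_lim _ (borel X) _ nu (fun n => graphing_op E (s n))) => [n|x].
  rewrite (_ : graphing_op E (s n) = fun x =>
      \sum_(c <- fset_set (range (s n))) c * graphing_op E \1_(s n @^-1` [set c]) x).
    apply: ae_measurable_sum => c; apply: ae_measurableZ.
    exact: graphing_op_indic_ae_measurable.
  apply/funext => x; rewrite graphing_opE.
  under eq_bigr do rewrite fimfunE fsbig_finite//=.
  by rewrite exchange_big; apply: eq_bigr => c _; rewrite graphing_opE mulr_sumr.
rewrite graphing_opE; under eq_cvg do rewrite graphing_opE.
elim: (gnbr x) => [|y r IHr].
  have -> : (fun n => \sum_(y <- [::]) s n y) = fun=> 0.
    by apply/funext => n; rewrite big_nil.
  by rewrite big_nil; exact: cvg_cst.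
have -> : (fun n => \sum_(z <- y :: r) s n z) =
    fun n => s n y + \sum_(z <- r) s n z.
  by apply/funext => n; rewrite big_cons.
by rewrite big_cons; apply: cvgD IHr; have := sf y I; rewrite [_ y]/= => /fine_cvg.
Qed.

End graphing_op.

(** * The norm bound for measurable versions *)

Section graphing_norm.
Context {R : realType} {X : ptopologicalType} {d : nat}.
Context {nu : probability (borel X) R} {E : set (X * X)}.
Hypothesis hE : ramanujan d nu E.
Let lam : R := 2 * Num.sqrt (d%:R - 1).

Lemma ramanujan_graphing_op (f g : X -> R) : L2_0 nu f ->
  measurable_fun (setT : set (borel X)) g ->
  {ae nu, forall x, graphing_op E f x = g x} ->
  g \in Lfun nu 2%:E /\ \int[nu]_x (g x ^+ 2) <= lam ^+ 2 * \int[nu]_x (f x ^+ 2).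
Proof.
move=> [f2 f0] mg fg.
have lam0 : 0 <= lam by rewrite mulr_ge0// sqrtr_ge0.
have if2 := Lfun2_integrable_sqr f2.
have ffin : (\int[nu]_x (f x ^+ 2)%:E \is a fin_num)%E by exact: integrable_fin_num.
set a := \int[nu]_x (f x ^+ 2); have aE : (\int[nu]_x (f x ^+ 2)%:E = a%:E)%E.
  by rewrite /a /Rintegral fineK.
have a0 : 0 <= a by apply: Rintegral_ge0 => x _; exact: sqr_ge0.
have mg2 : measurable_fun (setT : set (borel X)) (fun x => (g x ^+ 2)%:E).
  by apply/measurable_EFinP; exact: measurable_funX.
(* Normalising [f] by [sqrt (a + e)] instead of its norm [sqrt a] covers the case [a = 0]; at the
   end [e] tends to 0. *)
have key e : 0 < e -> (\int[nu]_x (g x ^+ 2)%:E <= (lam ^+ 2 * (a + e))%:E)%E.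
  move=> e0; have ae0 : 0 < a + e by rewrite ltr_wpDl.
  pose c := (Num.sqrt (a + e))^-1.
  have c2 : c ^+ 2 = (a + e)^-1 by rewrite exprVn sqr_sqrtr// ltW.
  pose h := fun x => c * f x.
  have h2 : h \in Lfun nu 2%:E.
    have -> : h = c \o* f by apply/funext => x; rewrite /h /= mulrC.
    by apply: Lfun_scale; rewrite ?ler1n.
  have hN : ('N[nu]_2%:E[EFin \o h] <= 1)%E.
    rewrite Lnorm2_le//.
    under eq_integral do rewrite /h exprMn EFinM.
    rewrite integralZl// aE c2 -EFinM lee_fin expr1n mulrC.
    by rewrite ler_pdivrMr// mul1r lerDl ltW.
  have h0 : (\int[nu]_x (h x)%:E = 0)%E.
    under eq_integral do rewrite /h EFinM.
    rewrite integralZl ?f0 ?mule0//; apply/Lfun1_integrable.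
    by apply: Lfun_subset12 f2; exact: fin_num_measure.
  have : ('N[nu]_2%:E[EFin \o graphing_op E h] <= lam%:E)%E.
    by apply: le_trans hE.2; apply: ereal_sup_ubound; exists h.
  rewrite Lnorm2_le// => H.
  (* [H] bounds a lower integral, which dominates that of the measurable version [c * g]. *)
  have {H} : (\int[nu]_x ((c * g x) ^+ 2)%:E <= (lam ^+ 2)%:E)%E.
    apply: le_trans H; apply: le_lower_integral_ae.
    - by apply: measurable_funX; exact: measurable_funM.
    - by move=> x; exact: sqr_ge0.
    - by move=> x; exact: sqr_ge0.
    move: fg => [N [mN N0 NS]]; exists N; split=> // x /= hx; apply: NS => /= gx.
    by apply: hx; rewrite -gx !(graphing_opE hE.1) mulr_sumr.
  under eq_integral do rewrite exprMn EFinM.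
  rewrite ge0_integralZl//; last 2 first.
  - by move=> x _; rewrite lee_fin sqr_ge0.
  - by rewrite lee_fin sqr_ge0.
  by rewrite c2 lee_pdivrMl// -EFinM mulrC.
have gfin : (\int[nu]_x (g x ^+ 2)%:E < +oo)%E.
  by apply: le_lt_trans (key 1 ltr01) _; rewrite ltry.
split; first exact: Lfun2P.
rewrite -lee_fin /Rintegral fineK; last first.
  by rewrite ge0_fin_numE// integral_ge0// => x _; rewrite lee_fin sqr_ge0.
have [l0|l0] := eqVneq lam 0.
  by have := key 1 ltr01; rewrite l0 expr0n /= !mul0r.
apply/lee_addgt0Pr => e e0.
have l2 : 0 < lam ^+ 2 by rewrite exprn_gt0// lt_def l0.
have := key (e / lam ^+ 2); rewrite divr_gt0// => /(_ isT).
by rewrite mulrDr mulrCA mulfV ?mulr1 ?gt_eqF.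
Qed.

End graphing_norm.

(** * The process on the tree *)

Section process.
Context {R : realType} {d : nat} {X : ptopologicalType}.
Context {nu : probability (borel X) R} {E : set (X * X)}.
Context {V : choiceType} {t : rel V} {phi0 : set_type (is_hom0 E t)}.
Context {kappa : probability (Hom0_space phi0) R}.
Hypotheses (hE : ramanujan d nu E) (ht : regular_tree d t).
Hypothesis hkappa : is_kappa nu kappa.
Hypothesis hd : (2 <= d)%N.
Local Notation Hom0_phi := (Hom0_space phi0).
Local Notation nbr := (nbr ht).
Local Notation tdist := (tdist ht).

Lemma measurable_eval_at u :
  measurable_fun (setT : set Hom0_phi) (eval_at phi0 u : Hom0_phi -> borel X).
Proof.
by move=> _ B mB; apply: sub_sigma_algebra; exists u => //; exists B.
Qed.

Lemma measurable_precomp a (ha : automorphism t a) :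
  measurable_fun (setT : set Hom0_phi) (precomp phi0 ha : Hom0_phi -> Hom0_phi).
Proof.
apply: (@measurability _ _ Hom0_phi Hom0_phi setT _ (cylinders phi0)) => //.
move=> _ [_ [u _ [B mB <-]] <-].
by rewrite !setTI; apply: sub_sigma_algebra; exists (a u) => //; exists B; rewrite ?setTI.
Qed.

(** [phi] injects the [d] neighbours of [u] into the [d] neighbours of its image, hence reaches all
    of them. *)
Lemma hom0_nbr (phi : Hom0_phi) u :
  perm_eq (map (val phi) (nbr u)) (gnbr hE.1 (val phi u)).
Proof.
have [hom inj] := set_valP phi.
have us : uniq (map (val phi) (nbr u)).
  rewrite map_inj_in_uniq ?nbr_uniq// => y z; rewrite !mem_nbr => uy uz.
  by apply: (inj u); rewrite inE.
have sub : {subset map (val phi) (nbr u) <= gnbr hE.1 (val phi u)}.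
  move=> _ /mapP[y + ->]; rewrite mem_nbr => /hom.
  by rewrite -[E _]/(neighbors E (val phi u) _) (neighborsE hE.1).
have [|_ H] := uniq_min_size us sub; first by rewrite size_map size_gnbr size_nbr.
by apply: uniq_perm; rewrite ?gnbr_uniq.
Qed.

Lemma graphing_op_eval (h : X -> R) (phi : Hom0_phi) u :
  graphing_op E h (eval_at phi0 u phi) = \sum_(w <- nbr u) h (eval_at phi0 w phi).
Proof.
rewrite (graphing_opE hE.1) -(perm_big _ (hom0_nbr phi u)) big_map.
by [].
Qed.

(** A mixed moment, neither centred nor normalised; it is the covariance as soon as [g] or [h] has
    mean zero. *)
Definition corr u w (g h : X -> R) : R :=
  \int[kappa]_phi (g (eval_at phi0 u phi) * h (eval_at phi0 w phi)).

Lemma Lfun2_eval (g : X -> R) u : g \in Lfun nu 2%:E ->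
  (fun phi : Hom0_phi => g (eval_at phi0 u phi)) \in Lfun kappa 2%:E.
Proof.
by apply: Lfun2_measure_preserving; [exact: measurable_eval_at|exact: hkappa.2].
Qed.

Lemma corrC u w g h : corr u w g h = corr w u h g.
Proof. by apply: eq_Rintegral => phi _; rewrite mulrC. Qed.

Lemma corr_diag u (g h : X -> R) : g \in Lfun nu 2%:E -> h \in Lfun nu 2%:E ->
  corr u u g h = \int[nu]_x (g x * h x).
Proof.
move=> g2 h2; rewrite -(Rintegral_measure_preserving (measurable_eval_at u) (hkappa.2 u))//.
by apply: measurable_funM; [exact: Lfun_measurable g2|exact: Lfun_measurable h2].
Qed.

Lemma corr_aut a u w (g h : X -> R) : automorphism t a ->
  g \in Lfun nu 2%:E -> h \in Lfun nu 2%:E ->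
  corr (a u) (a w) g h = corr u w g h.
Proof.
move=> ha g2 h2.
rewrite /corr -[RHS](Rintegral_measure_preserving (measurable_precomp ha) (hkappa.1 a ha))//.
by apply: measurable_funM;
  [exact: (Lfun_measurable (Lfun2_eval u g2))|exact: (Lfun_measurable (Lfun2_eval w h2))].
Qed.

(** The exceptional null set of [hh'] is pulled back along evaluation at [u], which carries [kappa]
    to [nu]. *)
Lemma corr_sum o u (g h h' : X -> R) : g \in Lfun nu 2%:E -> h \in Lfun nu 2%:E ->
  h' \in Lfun nu 2%:E -> {ae nu, forall x, graphing_op E h x = h' x} ->
  \sum_(w <- nbr u) corr o w g h = corr o u g h'.
Proof.
move=> g2 h2 h'2 hh'.
rewrite -Rintegral_sum; last first.
  by move=> w; apply: Lfun2_integrableM; exact: Lfun2_eval.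
apply: Rintegral_ae_eq.
- apply: measurable_sum => w.
  by apply: measurable_funM;
  [exact: (Lfun_measurable (Lfun2_eval o g2))|exact: (Lfun_measurable (Lfun2_eval w h2))].
- by apply: measurable_funM;
  [exact: (Lfun_measurable (Lfun2_eval o g2))|exact: (Lfun_measurable (Lfun2_eval u h'2))].
- apply: filterS (ae_measure_preserving (measurable_eval_at u) (hkappa.2 u) hh').
  by move=> phi <-; rewrite graphing_op_eval mulr_sumr.
Qed.

Lemma corr_child o u w w' (g h : X -> R) : g \in Lfun nu 2%:E -> h \in Lfun nu 2%:E ->
  t u w -> t u w' ->
  tdist o w = (tdist o u).+1 -> tdist o w' = (tdist o u).+1 ->
  corr o w g h = corr o w' g h.
Proof.
move=> g2 h2 tuw tuw' wu wu'.
have [a [ha ao aw]] := tree_child_transitive tuw tuw' wu wu'.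
by rewrite -(corr_aut o w ha)// ao aw.
Qed.

Lemma tdist_nbr u w : t u w -> tdist u w = (tdist u u).+1.
Proof.
by move=> /(tdist_edge ht u)[//|]; rewrite tdistxx.
Qed.

(** With [u] as root all its neighbours are children, so the sum in [corr_sum] has [d] equal
    terms. *)
Lemma corr_edge u w (g h h' : X -> R) : g \in Lfun nu 2%:E -> h \in Lfun nu 2%:E ->
  h' \in Lfun nu 2%:E -> {ae nu, forall x, graphing_op E h x = h' x} -> t u w ->
  d%:R * corr u w g h = \int[nu]_x (g x * h' x).
Proof.
move=> g2 h2 h'2 hh' tuw; rewrite -(corr_diag u)// -(corr_sum u u g2 h2 h'2 hh').
rewrite (eq_big_seq (fun=> corr u w g h)).
  by rewrite big_const_seq count_predT size_nbr iter_addr_0 mulr_natl.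
move=> w'; rewrite mem_nbr => tuw'; apply: (@corr_child u u) => //; exact: tdist_nbr.
Qed.

Lemma tree_has_nbr u : exists w, t u w.
Proof.
have := size_nbr ht u; have := @mem_nbr _ _ _ ht u.
case: (nbr u) => [|w s] H; first by move=> d0; move: hd; rewrite -d0.
by exists w; rewrite -H mem_head.
Qed.

(** Each side is [d] times the correlation across one edge, read from either end. *)
Lemma graphing_op_selfadjoint (g h g' h' : X -> R) (o : V) :
  g \in Lfun nu 2%:E -> h \in Lfun nu 2%:E ->
  g' \in Lfun nu 2%:E -> h' \in Lfun nu 2%:E ->
  {ae nu, forall x, graphing_op E g x = g' x} ->
  {ae nu, forall x, graphing_op E h x = h' x} ->
  \int[nu]_x (g x * h' x) = \int[nu]_x (g' x * h x).
Proof.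
move=> g2 h2 g'2 h'2 gg' hh'; have [w tow] := tree_has_nbr o.
rewrite -(corr_edge g2 h2 h'2 hh' tow) corrC.
rewrite (corr_edge h2 g2 g'2 gg'); last by rewrite (tree_sym ht).
by apply: eq_Rintegral => x _; rewrite mulrC.
Qed.

(** The mean of the image is a correlation with the constant 1, hence a sum over the neighbours of
    [o] of means of [f]. *)
Lemma L2_0_graphing_op (o : V) (f : X -> R) : L2_0 nu f ->
  exists g, L2_0 nu g /\ {ae nu, forall x, graphing_op E f x = g x}.
Proof.
move=> f20; have [f2 f0] := f20.
have [g mg fg] := graphing_op_ae_measurable hE.1 (Lfun_measurable f2).
have [g2 _] := ramanujan_graphing_op hE f20 mg fg.
exists g; split=> //; split=> //.
have one2 : (cst 1 : borel X -> R) \in Lfun nu 2%:E by exact: Lfun_cst.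
have C0 w : corr o w (cst 1) f = 0.
  rewrite /corr; under eq_Rintegral do rewrite mul1r.
  by rewrite (Rintegral_measure_preserving (measurable_eval_at w) (hkappa.2 w)
    (Lfun_measurable f2)) /Rintegral f0.
have : \int[nu]_x (cst 1 x * g x) = 0.
  rewrite -(corr_diag o)// -(corr_sum o o one2 f2 g2 fg) big1// => w _.
under eq_Rintegral do rewrite mul1r.
have gfin : (\int[nu]_x (g x)%:E \is a fin_num)%E.
  apply: integrable_fin_num => //; apply/Lfun1_integrable.
  by apply: Lfun_subset12 g2; exact: fin_num_measure.
by rewrite /Rintegral => g0; rewrite -(fineK gfin) g0.
Qed.

(** * Polynomials in the graphing operator *)

Section spectral.
Implicit Types P Q S : {poly R}.
Variables (o : V) (G : nat -> X -> R).
Hypothesis G20 : forall i, L2_0 nu (G i).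
Hypothesis GS : forall i, {ae nu, forall x, graphing_op E (G i) x = G i.+1 x}.

(* A version of [P(A) (G 0)], with [A] the graphing operator. *)
Definition polyG (P : {poly R}) (x : X) : R := \sum_(i < size P) P`_i * G i x.

Lemma polyG_widen n P x : (size P <= n)%N -> polyG P x = \sum_(i < n) P`_i * G i x.
Proof.
move=> Pn; rewrite /polyG (big_ord_widen n (fun i => P`_i * G i x) Pn).
rewrite [RHS](bigID (fun i : 'I_n => (i < size P)%N)) /=.
rewrite [X in _ = _ + X]big1 ?addr0// => i; rewrite -leqNgt => Pi.
by rewrite nth_default ?mul0r.
Qed.

Lemma polyG_lin a P Q x : polyG (a *: P + Q) x = a * polyG P x + polyG Q x.
Proof.
pose n := maxn (size P) (size Q).
rewrite !(@polyG_widen n) ?leq_maxl ?leq_maxr//; last first.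
  rewrite (leq_trans (size_polyD _ _))// geq_max leq_maxr andbT.
  by rewrite (leq_trans (size_scale_leq _ _)) ?leq_maxl.
rewrite mulr_sumr -big_split; apply: eq_bigr => i _ /=.
by rewrite coefD coefZ mulrDl mulrA.
Qed.

Lemma polyG1 x : polyG 1 x = G 0 x.
Proof. by rewrite /polyG size_poly1 big_ord1 coef1 mul1r. Qed.

Lemma polyGX P x : polyG ('X * P) x = \sum_(i < size P) P`_i * G i.+1 x.
Proof.
rewrite (@polyG_widen (size P).+1); last first.
  by rewrite (leq_trans (size_polyMleq _ _))// size_polyX.
rewrite big_ord_recl coefXM mul0r add0r; apply: eq_bigr => i _.
by rewrite coefXM.
Qed.

Lemma polyG2 P : (polyG P : borel X -> R) \in Lfun nu 2%:E.
Proof.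
have -> : polyG P = fun x => \sum_(i < size P) P`_i * G i x by [].
by apply: Lfun2_sum => i; exact: (G20 i).1.
Qed.

Lemma graphing_op_polyG P : {ae nu, forall x, graphing_op E (polyG P) x = polyG ('X * P) x}.
Proof.
have [N [mN N0 NS]] := ae_foralln GS; exists N; split=> // x /= hx.
apply: NS => /= H; apply: hx.
rewrite polyGX (graphing_opE hE.1) exchange_big; apply: eq_bigr => i _.
by rewrite -H (graphing_opE hE.1) mulr_sumr.
Qed.

Lemma polyG20 P : L2_0 nu (polyG P).
Proof.
split; first exact: polyG2.
have G1 i : nu.-integrable setT (EFin \o G i).
  apply/Lfun1_integrable.
  by apply: Lfun_subset12 (G20 i).1; exact: fin_num_measure.
rewrite /polyG; under eq_integral do rewrite -sumEFin.
rewrite integral_sum//; last first.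
  by move=> i; exact: (integrableZl measurableT P`_i (G1 i)).
rewrite big1// => i _; under eq_integral do rewrite EFinM.
rewrite (integralZl measurableT (G1 i)) [X in (_ * X)%E](_ : _ = 0%E) ?mule0//.
exact: (G20 i).2.
Qed.

Definition innerG (P Q : {poly R}) : R := \int[nu]_x (polyG P x * polyG Q x).

Lemma innerG_linr a P Q S : innerG P (a *: Q + S) = a * innerG P Q + innerG P S.
Proof.
have iM A B := Lfun2_integrableM (polyG2 A) (polyG2 B).
rewrite /innerG -(RintegralZl a measurableT (iM P Q)).
have iaM : nu.-integrable setT (EFin \o (fun x => a * (polyG P x * polyG Q x))).
  exact: (integrableZl measurableT a (iM P Q)).
rewrite -(RintegralD measurableT iaM (iM P S)).
by apply: eq_Rintegral => x _; rewrite polyG_lin mulrDr mulrCA.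
Qed.

Lemma innerGC P Q : innerG P Q = innerG Q P.
Proof. by apply: eq_Rintegral => x _; rewrite mulrC. Qed.

Lemma innerGX P Q : innerG P ('X * Q) = innerG ('X * P) Q.
Proof.
apply: graphing_op_selfadjoint => //; do ?exact: polyG2; exact: graphing_op_polyG.
Qed.

(** This is integration against the spectral measure of the operator at [G 0], without constructing
    that measure. *)
Definition spectral (P : {poly R}) : R := innerG 1 P.

Lemma spectral_linear : linear_for *%R spectral.
Proof. by move=> a P Q; exact: innerG_linr. Qed.

HB.instance Definition _ := GRing.isLinear.Build R {poly R} R *%R spectral spectral_linear.

(** Self-adjointness moves the factors ['X] of [P] to the other side one at a time. *)
Lemma innerGE P Q : innerG P Q = spectral (P * Q).
Proof.
elim/poly_ind: P Q => [|P c IHP] Q.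
  rewrite mul0r raddf0 /innerG.
  under eq_Rintegral do rewrite /polyG size_poly0 big_ord0 mul0r.
  by rewrite Rintegral_cst ?mul0r.
have -> : P * 'X + c%:P = c *: 1 + 'X * P by rewrite alg_polyC addrC mulrC.
rewrite innerGC innerG_linr innerGC -/(spectral Q) innerGC -innerGX IHP.
by rewrite -spectral_linear; congr spectral; rewrite -!mul_polyC; ring.
Qed.

Lemma spectral_ge0 P : 0 <= spectral (P * P).
Proof.
rewrite -innerGE; apply: Rintegral_ge0 => x _; exact: sqr_ge0.
Qed.

Lemma spectral_bound P :
  spectral ('X * P * ('X * P)) <= (2 * Num.sqrt (d%:R - 1)) ^+ 2 * spectral (P * P).
Proof.
rewrite -!innerGE.
have [_] := ramanujan_graphing_op hE (polyG20 P) (Lfun_measurable (polyG2 _))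
  (graphing_op_polyG P).
by [].
Qed.

(** [P] is arbitrary because summing over the neighbours of the parent of [w] replaces it by
    ['X * P]. *)
Lemma corr_polyG k w P : tdist o w = k ->
  corr o w (G 0) (polyG P) = spectral (nb_poly d k * P).
Proof.
have G0 : G 0 = polyG 1 by apply/funext => x; rewrite polyG1.
have G02 := (G20 0).1; have d0 : d%:R != 0 :> R by rewrite pnatr_eq0; lia.
suff: (forall w P, tdist o w = k -> corr o w (G 0) (polyG P) = spectral (nb_poly d k * P)) /\
   (forall w P, tdist o w = k.+1 -> corr o w (G 0) (polyG P) = spectral (nb_poly d k.+1 * P)).
  by move=> [H _]; exact: H.
elim: k {w P} => [|k [IH1 IH2]]; split=> // w P.
- move=> /eqP; rewrite tdist_eq0 => /eqP->.
  by rewrite corr_diag ?polyG2// nb_poly0 mul1r /spectral /innerG G0.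
- move=> w1; have wo : w != o by rewrite -(tdist_eq0 ht) w1.
  have [twp] := parP ht wo; rewrite w1 => -[/eqP]; rewrite tdist_eq0 => /eqP po.
  rewrite po (tree_sym ht) in twp.
  apply: (mulfI d0); rewrite (corr_edge G02 (polyG2 _) (polyG2 _) (graphing_op_polyG _) twp).
  by rewrite nb_poly1 -scalerAl linearZ /= mulrA mulfV// mul1r G0.
- move=> wk; have wo : w != o by rewrite -(tdist_eq0 ht) wk.
  have [] := parP ht wo; set u := par ht o w => twu; rewrite wk => -[uk].
  have uo : u != o by rewrite -(tdist_eq0 ht) uk.
  have [] := parP ht uo; set p := par ht o u => tup; rewrite uk => -[pk].
  (* Around [u], the parent of [w], the sum has one term at distance [k], for the parent [p] of [u],
     and [d - 1] terms for the children of [u], all equal to that of [w]. This is the recurrence of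
     [nb_poly]. *)
  have := corr_sum o u G02 (polyG2 P) (polyG2 _) (graphing_op_polyG P).
  rewrite IH2// (bigD1_seq p) ?mem_nbr ?nbr_uniq//= IH1//.
  rewrite big_seq_cond (eq_bigr (fun=> corr o w (G 0) (polyG P))); last first.
    move=> w' /andP[]; rewrite mem_nbr => tuw' w'p.
    apply: (@corr_child o u) => //; rewrite ?polyG2//.
    + by rewrite (tree_sym ht).
    + have [//|uw'] := tdist_edge ht o tuw'.
      case/eqP: w'p; apply: (@tree_unique_parent _ _ _ ht o u) => //.
        by rewrite uw'.
      by rewrite uk pk.
    + by rewrite wk uk.
  rewrite -big_seq_cond big_const_seq iter_addr_0.
  have -> : count (fun i => i != p) (nbr u) = d.-1.
    have := count_predC (pred1 p) (nbr u).
    rewrite size_nbr count_uniq_mem ?nbr_uniq// mem_nbr tup.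
    by rewrite -[count (fun i => i != p) _]/(count (predC (pred1 p)) _); lia.
  have d1 : d.-1%:R = d%:R - 1 :> R by rewrite -subn1 natrB//; lia.
  have d10 : d%:R - 1 != 0 :> R by rewrite -d1 pnatr_eq0; lia.
  rewrite -mulr_natl d1 => H; apply: (mulfI d10).
  rewrite nb_polySS -scalerAl linearZ /= mulrA mulfV// mul1r [in RHS]mulrBl raddfB /=.
  rewrite -(addKr (spectral (nb_poly d k * P)) (_ * corr _ _ _ _)) H addrC.
  by congr (spectral _ - _); ring.
Qed.

End spectral.

(** A choice of versions in [L2_0] is iterated; off [L2_0] the chosen property is vacuous, so
    [choice] applies to all functions. *)
Lemma graphing_op_sequence (o : V) (f : X -> R) : L2_0 nu f ->
  exists G : nat -> X -> R, [/\ G 0 = f, forall i, L2_0 nu (G i) &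
    forall i, {ae nu, forall x, graphing_op E (G i) x = G i.+1 x}].
Proof.
move=> f20.
have ex (h : X -> R) : exists g, L2_0 nu h ->
    L2_0 nu g /\ {ae nu, forall x, graphing_op E h x = g x}.
  have [/(L2_0_graphing_op o)[g gP]|nh] := pselect (L2_0 nu h); first by exists g.
  by exists h => /nh.
have [S SP] := choice ex.
have G20 i : L2_0 nu (iter i S f) by elim: i => //= i IH; exact: (SP _ IH).1.
by exists (fun i => iter i S f); split=> // i; exact: (SP _ (G20 i)).2.
Qed.

Lemma covariance_process (f : X -> R) v w : f \in Lfun nu 2%:E ->
  let f0 x := f x - \int[nu]_y f y in
  fine (covariance kappa (process f v) (process f w)) = corr v w f0 f0.
Proof.
move=> f2 f0; rewrite unlock unlock /corr /Rintegral.
have Ef u : fine (\int[kappa]_phi (process f u phi)%:E) = \int[nu]_y f y.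
  exact: (Rintegral_measure_preserving (measurable_eval_at u) (hkappa.2 u) (Lfun_measurable f2)).
by rewrite !Ef.
Qed.

End process.

Theorem theorem3p1 (R : realType) (d : nat) (hd : (2 <= d)%N)
    (X : ptopologicalType) (hX : polish R X) (nu : probability (borel X) R)
    (E : set (X * X)) (hE : ramanujan d nu E)
    (V : choiceType) (t : rel V) (ht : regular_tree d t)
    (phi0 : set_type (is_hom0 E t))
    (kappa : probability (Hom0_space phi0) R) (hkappa : is_kappa nu kappa)
    (f : X -> R) (hf : f \in Lfun nu 2%:E)
    (hfc : ~ exists c : R, {ae nu, forall x, f x = c})
    (k : nat) (v w : V) (hvw : at_distance t v w k) :
  `|correlation kappa (process f v) (process f w)| <=
  (k%:R + 1 - 2 * k%:R / d%:R) * (1 / Num.sqrt (d%:R - 1)) ^+ k.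
Proof.
pose m := \int[nu]_y f y; pose f0 x := f x - m.
have f02 : L2_0 nu f0.
  have f1 : nu.-integrable setT (EFin \o f).
    apply/Lfun1_integrable.
    by apply: Lfun_subset12 hf; exact: fin_num_measure.
  split.
    have -> : f0 = fun x => 1 * f x + cst (- m) x by apply/funext => x; rewrite mul1r.
    by apply: Lfun2_lin => //; exact: Lfun_cst.
  under eq_integral do rewrite EFinB.
  rewrite integralB//; last exact: finite_measure_integrable_cst.
  rewrite integral_cst//= probability_setT mule1 /m /Rintegral fineK ?subee//.
    exact: integrable_fin_num.
  exact: integrable_fin_num.
have [G [G0 G20 GS]] := graphing_op_sequence hE ht hkappa v f02.
pose L := spectral (nu := nu) G.
have covE x y j : tdist ht x y = j ->
    fine (covariance kappa (process f x) (process f y)) = L (nb_poly d j).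
  move=> xy; rewrite (covariance_process hkappa)// -[LHS]/(corr (kappa := kappa) x y f0 f0).
  rewrite -G0 /L -[nb_poly d j]mulr1 -(corr_polyG hE hkappa hd G20 GS _ xy).
  by congr (corr _ _ _ _); apply/funext => z; rewrite polyG1.
rewrite /correlation (covE v w k); last exact/tdistP.
(* Variances are covariances at distance 0, so both factors of the denominator are the square root
   of [L 1]. *)
rewrite !(covE _ _ 0%N) ?tdistxx// nb_poly0.
have L0 : 0 <= L 1 by rewrite -[1]mulr1; exact: (spectral_ge0 hE ht hkappa hd v G20 GS).
have s0 : 0 < Num.sqrt (d%:R - 1) :> R.
  by rewrite sqrtr_gt0 subr_gt0 ltr1n.
have dR : 2 <= d%:R :> R by rewrite ler_nat.
have ss : Num.sqrt (d%:R - 1) ^+ 2 = d%:R - 1 :> R by rewrite sqr_sqrtr// subr_ge0 ler1n ltnW.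
have bnd := functional_nb_poly (L := spectral G) (spectral_ge0 hE ht hkappa hd v G20 GS)
  (spectral_bound hE ht hkappa hd v G20 GS) s0 k hd ss.
rewrite -expr2 sqr_sqrtr// normrM normfV (ger0_norm L0).
(* If [L 1] is 0, the quotient is 0 by the convention for division, and the right-hand side only has
   to be nonnegative. *)
move: L0; rewrite le_eqVlt => /predU1P[<-|L0].
  rewrite invr0 mulr0; apply: mulr_ge0; last by rewrite exprn_ge0// divr_ge0// ltW.
  have d0 : 0 < d%:R :> R by lra.
  have : 2 * k%:R / d%:R <= k%:R :> R.
    by rewrite ler_pdivrMr// mulrC ler_wpM2l.
  by lra.
by rewrite ler_pdivrMr//; exact: bnd.
Qed.
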